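(* Let $n\ge1$, $\pi\in S_n$ and $\lambda=(\lambda_1,\lambda_2,\ldots)=\mathrm{shape}(\pi)$. Then $\mathrm{weakbump}(\pi)=n-\lambda_1$.
   Context: $S_n$ is the set of permutations $\pi=\pi_1\cdots\pi_n$ (one-line notation) of $\{1,\ldots,n\}$. Robinson–Schensted (RS) correspondence: tableaux are fillings of Young diagrams with distinct positive integers increasing along rows and down columns. To insert $k$ into a tableau $P$ (written $P\leftarrow k$), start with the top row: (I1) if $k$ is greater than or equal to the rightmost entry of the current row, or the current row is empty, append $k$ at the end of that row and stop; (I2) otherwise let $y$ be the leftmost entry of the current row with $k<y$, replace $y$ by $k$ (this is one bump), set $k:=y$, move down one row and go to (I1). For $\pi\in S_n$, let $P_0$ be the empty tableau and $P_i=P_{i-1}\leftarrow\pi_i$ for $1\le i\le n$. The partition $\mathrm{shape}(\pi)=(\lambda_1,\lambda_2,\ldots)$ of $n$ is the shape of $P_n$, with $\lambda_i$ the length of row $i$. Let $\mathrm{bump}_i(\pi)$ be the number of bumps that occur during the insertion $P_{i-1}\leftarrow\pi_i$; let $\mathrm{weakbump}_i(\pi)=1$ if $\mathrm{bump}_i(\pi)>0$ and $0$ otherwise; and let $\mathrm{weakbump}(\pi)=\sum_{i=1}^n\mathrm{weakbump}_i(\pi)$. *)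

(* Defs.v *)
From mathcomp Require Import all_boot all_order all_fingroup all_algebra.

Set Implicit Arguments.
Unset Strict Implicit.
Unset Printing Implicit Defensive.

(* A tableau is the list of its rows, top row first, each row read from left
   to right; rows below the last one in the list are empty. *)
Definition tableau := seq (seq nat).

(* [rs_insert P k] is the pair of the tableau P <- k and the number of bumps
   that occur during this insertion. *)
Fixpoint rs_insert (P : tableau) (k : nat) : tableau * nat :=
  match P with
  | [::] => ([:: [:: k]], 0)
  | r :: P' =>
      if nilp r || (last 0 r <= k) then (rcons r k :: P', 0)
      else
        let j := find (fun y => k < y) r in
        let (Q, b) := rs_insert P' (nth 0 r j) in
        (set_nth 0 r j k :: Q, b.+1)
  end.

(* Positions and values of [pi : 'S_n] range over 0, ..., n-1, so the letter at
   position [i] of the one-line notation is [(pi i).+1]. *)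
Definition oneline (n : nat) (pi : 'S_n) : seq nat :=
  [seq (val (pi i)).+1 | i <- enum 'I_n].

(* The tableau P_m obtained from the first [m] letters. *)
Definition rs_tableau (n : nat) (pi : 'S_n) (m : nat) : tableau :=
  foldl (fun P k => (rs_insert P k).1) [::] (take m (oneline pi)).

(* [shape] of seq.v lists the lengths of the rows; lambda_i is its item i-1. *)
Definition rs_shape (n : nat) (pi : 'S_n) : seq nat :=
  shape (rs_tableau pi n).

(* For [i : 'I_n], the letter at position [i] is inserted into P_i, so
   [bump_at pi i] and [weakbump_at pi i] are bump_{i+1} and weakbump_{i+1}. *)
Definition bump_at (n : nat) (pi : 'S_n) (i : 'I_n) : nat :=
  (rs_insert (rs_tableau pi i) (val (pi i)).+1).2.

Definition weakbump_at (n : nat) (pi : 'S_n) (i : 'I_n) : nat :=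
  if 0 < bump_at pi i then 1 else 0.

Definition weakbump (n : nat) (pi : 'S_n) : nat :=
  \sum_(i < n) weakbump_at pi i.

(* Main.v *)
Require Import Defs.
From mathcomp Require Import all_boot all_order all_fingroup all_algebra.

(** The statistic only sees the first row of the tableau.  Inserting a letter either
    appends it to the first row, with no bump at all, or replaces an entry of
    the first row, with at least one bump and no change of length.  So every
    letter contributes exactly one unit, either to [lambda_1] or to the weak
    bump statistic ([first_row_insert]); summing over the [n] letters,
    from the empty tableau on, gives [weakbump + lambda_1 = n] ([weakbump_first_row]). *)

Definition first_row_length (P : tableau) : nat := nth 0 (shape P) 0.

(** The last entry of the row exceeds [k], so the search stops there at the
    latest.  Hence [set_nth] overwrites an entry and cannot lengthen the row. *)
Lemma find_replaced (r : seq nat) (k : nat) :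
  ~~ (nilp r || (last 0 r <= k)) -> find (fun y => k < y) r < size r.
Proof.
rewrite negb_or -ltnNge -has_find; case: r => //= x r lt_k.
by apply/(@hasP _ (fun y => k < y) (x :: r)); exists (last x r); rewrite ?mem_last.
Qed.

Lemma first_row_insert (P : tableau) (k : nat) :
  (0 < (rs_insert P k).2) + first_row_length (rs_insert P k).1
    = (first_row_length P).+1.
Proof.
case: P => [|r P] //=; case: ifP => [_|/negbT /find_replaced lt_j].
  by rewrite /first_row_length /= size_rcons.
case: (rs_insert P _) => Q b; rewrite /first_row_length /= size_set_nth.
by rewrite (maxn_idPr lt_j).
Qed.

Lemma size_oneline (n : nat) (pi : 'S_n) : size (oneline pi) = n.
Proof. by rewrite size_map size_enum_ord. Qed.

Lemma nth_oneline (n : nat) (pi : 'S_n) (i : 'I_n) :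
  nth 0 (oneline pi) i = (val (pi i)).+1.
Proof. by rewrite (nth_map i) ?size_enum_ord // nth_ord_enum. Qed.

Lemma rs_tableauS (n : nat) (pi : 'S_n) (m : nat) : m < n ->
  rs_tableau pi m.+1
    = (rs_insert (rs_tableau pi m) (nth 0 (oneline pi) m)).1.
Proof.
by move=> lt_mn; rewrite /rs_tableau (take_nth 0) ?size_oneline // foldl_rcons.
Qed.

Lemma weakbump_first_row (n : nat) (pi : 'S_n) :
  weakbump pi + first_row_length (rs_tableau pi n) = n.
Proof.
(* Indexing by nat, not by 'I_n, allows an induction on partial sums. *)
pose wb i :=
  nat_of_bool (0 < (rs_insert (rs_tableau pi i) (nth 0 (oneline pi) i)).2).
have -> : weakbump pi = \sum_(i < n) wb i.
  apply: eq_bigr => i _.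
  by rewrite /weakbump_at /bump_at /wb nth_oneline; case: ifP.
suff partial m : m <= n ->
    \sum_(i < m) wb i + first_row_length (rs_tableau pi m) = m.
  exact: partial.
elim: m => [|m IHm] lt_mn; first by rewrite big_ord0 /rs_tableau take0.
rewrite big_ord_recr /= rs_tableauS // -addnA first_row_insert addnS.
by rewrite IHm // ltnW.
Qed.

Theorem proposition18 (n : nat) (hn : (1 <= n)%N) (pi : 'S_n)
    (lambda : seq nat) (hlambda : lambda = rs_shape pi) :
  ((weakbump pi)%:Z = n%:Z - (nth 0%N lambda 0)%:Z)%R.
Proof.
rewrite hlambda -[in n%:Z%R](weakbump_first_row n pi) PoszD.
by rewrite GRing.addrK.
Qed.
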